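(* Let $\upsilon=\delta_{\mathcal U}$, with $\mathcal U\in\mathscr U$, be an attractive CA and, for some $p\in[0,1]$, let $\widetilde\eta$ be its version with death, i.e. the PCA with rates measure $\widetilde\upsilon=p\upsilon+(1-p)\delta_{\varnothing}$. Let $(\mathcal U_{x,t})_{(x,t)\in\mathbb Z^{d+1}}$ be the i.i.d. up-family field with law $\widetilde\upsilon$ used to construct $\widetilde\eta$. Define the $(d+1)$-dimensional update family $$\mathcal X=\{R\setminus D:D\in\Omega_R\setminus\mathcal U\}.$$ Consider the bootstrap percolation (BP) process $\omega$ on $\mathbb Z^{d+1}$ with update family $\mathcal X$ and initial condition $(\mathbf 1_{\{\mathcal U_{x,t}=\varnothing\}})_{(x,t)\in\mathbb Z^{d+1}}$. Define its closure $$C=\{(x,t)\in\mathbb Z^{d+1}:\exists s\in\{0,1,\dots\},\ \omega_{(x,t)}(s)=1\}$$ and the configuration $C_0=(\mathbb Z^d\times([-r,0)\cap\mathbb Z))\setminus C$. Then for all integers $t\ge0$ $$\widetilde\eta^{C_0}(t)=\{x\in\mathbb Z^d:(x,t)\notin C\},$$ and this is a version of the stationary $\widetilde\upsilon$-PCA at its upper invariant measure, that is, the limit as $t\to\infty$ of the law of $\widetilde\eta^{\mathbf 1}(t)$. In particular, $C=\mathbb Z^{d+1}$ a.s. if and only if $\delta_{\mathbf 0}$ is the unique invariant measure of the $\widetilde\upsilon$-PCA. Moreover, the map $\mathcal U\leftrightarrow\mathcal X$ is a one-to-one correspondence between $d$-dimensional attractive CA and $(d+1)$-dimensional BP with update family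 contained in the lower half-space $\mathbb Z^d\times\{-1,-2,\dots\}$ (for fixed range $r$: between up-families $\mathcal U\subset\Omega_R$ and BP with update family consisting of subsets of $R$).
   Context: Fix an integer $d\ge 1$ and a range $r\in[1,\infty)$. Set $R=([-r,r]^d\times[-r,0))\cap\mathbb Z^{d+1}$. For any set $X$, elements of $\{0,1\}^X$ are identified with subsets of $X$ (the set of points with value $1$). A configuration is an element of $\Omega=\{0,1\}^{\mathbb Z^d\times([-r,0)\cap\mathbb Z)}$. Let $\Omega_R=\{0,1\}^R$, identified with the power set of $R$. An up-family is a collection $\mathcal U\subset\Omega_R$ such that $X\in\mathcal U$ and $X\subset Y\subset R$ imply $Y\in\mathcal U$. Let $\mathscr U$ be the (finite) system of all up-families (including the empty one). An attractive PCA is a probability measure on $\mathscr U$; it is an attractive CA if it is a Dirac measure. $\delta_\varnothing$ is the Dirac mass at the empty up-family. Given a rates measure $\upsilon$, let $(\mathcal U_{x,t})_{(x,t)\in\mathbb Z^d\times\mathbb Z}$ be i.i.d. with law $\upsilon$. Given $\omega\in\Omega$, the process $\eta^\omega$ started from $\omega$ has $\eta^\omega_x(s)=\omega_{(x,s)}$ for $s\in[-r,0)\cap\mathbb Z$, and, inductively for integers $t\ge0$ and $x\in\mathbb Z^d$, $\eta^\omega_x(t)=1$ if $\{(y,s)\in R:\eta^\omega_{x+y}(t+s)=1\}\in\mathcal U_{x,t}$ and $\eta^\omega_x(t)=0$ otherwise (the same definition is used for random initial configurations which are functions of the field $(\mathcal U_{x,t})_{(x,t)\in\mathbb Z^{d+1}}$,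 such as $C_0$). $\mathbf 0,\mathbf 1$ denote the all-$0$ and all-$1$ configurations. An invariant measure is a probability measure on $\Omega$ such that, if the initial configuration has this law and is independent of $(\mathcal U_{x,t})_{t\ge0}$, then for all $t\ge0$ the configuration $(\eta_x(t+s))_{x\in\mathbb Z^d,\,s\in[-r,0)\cap\mathbb Z}$ has the same law. The upper invariant measure is the limit as $t\to\infty$ of the law of this configuration for the process started from $\mathbf 1$. A $(d+1)$-dimensional update family is a finite family $\mathcal X$ of finite subsets of $\mathbb Z^{d+1}\setminus\{0\}$ (both the family and the sets in it may be empty). The BP $\omega$ with update family $\mathcal X$ is the discrete-time deterministic process on $\{0,1\}^{\mathbb Z^{d+1}}$, with $\omega(0)$ the initial condition, in which at each step, simultaneously for all sites, the state of $z\in\mathbb Z^{d+1}$ becomes $1$ if it is already $1$ or some $X\in\mathcal X$ has all elements of $z+X$ in state $1$, and is $0$ otherwise. A BP is identified with the up-family generated by its update family, i.e. update families consisting of subsets of $R$ that generate the same up-family of $\Omega_R$ are identified, as they define the same process. *)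

(* Defs.v *)
From HB Require Import structures.
From mathcomp Require Import all_boot all_order all_algebra finmap.
From mathcomp Require Import all_classical all_reals all_analysis.
From mathcomp Require Import zify.

Set Implicit Arguments.
Unset Strict Implicit.
Unset Printing Implicit Defensive.

Import Order.TTheory GRing.Theory Num.Theory.
Import numFieldNormedType.Exports.

Local Open Scope classical_set_scope.
Local Open Scope ring_scope.

(* Z^(d+1) = Z^d x Z; the last coordinate is time. *)
Notation spacetime d := ('rV[int]_d * int)%type.

Section Range.
Context {K : realType}.
Variables (d : nat) (r : K).

Definition range_set : set (spacetime d) :=
  [set z : spacetime d | (forall i, ((z.1 0 i)%:~R : K) \in `[-r, r]%R) /\
                         (z.2%:~R : K) \in `[-r, 0[%R].

Lemma finite_range_set : finite_set range_set.
Proof.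
pose n := `|Num.floor r|%N.
have int_le (k : int) : (k%:~R : K) \in `[-r, r]%R -> (`|k| <= n)%N.
  rewrite in_itv /= => kr; have : `|k|%:~R <= r by rewrite intr_norm ler_norml.
  by rewrite -floor_ge_int -abszE /n; case: (Num.floor r) => *; lia.
pose g (u : {ffun 'I_d -> 'I_(n + n).+1} * 'I_(n + n).+1) : spacetime d :=
  (\row_i ((u.1 i)%:Z - n%:Z), (u.2)%:Z - n%:Z).
apply: (@sub_finite_set _ _ (g @` setT)); last exact/finite_image/finite_finset.
have sh (k : int) : (`|k| <= n)%N ->
    (@inord (n + n) (absz (k + n%:Z)))%:Z - n%:Z = k.
  by move=> kn; rewrite inordK; lia.
move=> [x t] [/= hx]; rewrite in_itv /= => /andP[ht1 ht2].
exists ([ffun i => inord (absz (x 0 i + n%:Z))],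
  inord (absz (t + n%:Z))) => //=.
rewrite /g /=; congr pair.
  by apply/rowP => i; rewrite mxE ffunE sh // int_le.
rewrite sh // int_le // in_itv /= ht1 /= (le_trans (ltW ht2)) //.
by rewrite -oppr_le0 (le_trans ht1 (ltW ht2)).
Qed.

Definition range_fset : {fset spacetime d} := fset_set range_set.

Lemma in_range_fset z : (z \in range_fset) =
  [forall i, ((z.1 0 i)%:~R : K) \in `[-r, r]%R] &&
  ((z.2%:~R : K) \in `[-r, 0[%R).
Proof.
rewrite in_fset_set; last exact: finite_range_set.
apply/idP/andP; first by rewrite inE => -[/= zx zt]; split=> //; apply/forallP.
by move=> [/forallP zx zt]; rewrite inE.
Qed.

End Range.

Section UpFamilies.
Context {K : realType}.
Variables (d : nat) (r : K).

Definition is_upfamily (U : {fset {fset spacetime d}}) : Prop :=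
  (forall X, X \in U -> X `<=` range_fset d r)%fset /\
  (forall X Y, X \in U -> X `<=` Y -> Y `<=` range_fset d r -> Y \in U)%fset.

Record upfamily := UpFamily {
  members : {fset {fset spacetime d}};
  membersP : `[< is_upfamily members >] }.

HB.instance Definition _ := [isSub for members].
HB.instance Definition _ := [Choice of upfamily by <:].

Lemma is_upfamily0 : `[< is_upfamily fset0 >].
Proof. by apply/asboolP; split=> X; rewrite inE. Qed.

Definition empty_upfamily : upfamily := UpFamily is_upfamily0.

HB.instance Definition _ := isPointed.Build upfamily empty_upfamily.

(* The system of up-families is finite: every set is an event. *)
HB.instance Definition _ := @isMeasurable.Build default_measure_display
  upfamily discrete_measurable discrete_measurable0
  discrete_measurableC discrete_measurableU.

Lemma is_upfamily_generated (Y : {fset {fset spacetime d}}) :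
  `[< is_upfamily
    [fset Z in fpowerset (range_fset d r)
      | has (fun X => X `<=` Z) Y]%fset >].
Proof.
apply/asboolP; split=> [X|X Z].
  by rewrite !inE fpowersetE => /andP[].
rewrite !inE !fpowersetE => /andP[_ /hasP[W WY WX]] XZ ZR /=.
rewrite ZR; apply/hasP; exists W => //; exact: fsubset_trans XZ.
Qed.

(* The up-family of Omega_R generated by Y, i.e. the BP with update family Y *)
Definition generated Y : upfamily := UpFamily (is_upfamily_generated Y).

End UpFamilies.
Arguments generated {K d} r Y.

Section Configurations.
Context {K : realType}.
Variables (d : nat) (r : K).

Definition past : set int := [set s : int | (s%:~R : K) \in `[-r, 0[%R].

Definition coordinate : Type := ('rV[int]_d * past)%type.

Definition cylinders : set (set (coordinate -> bool)) :=
  [set [set w : coordinate -> bool | w i] | i in setT].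

(* Omega, with its product sigma-algebra *)
Definition config : Type := g_sigma_algebraType cylinders.
HB.instance Definition _ := Measurable.on config.

Definition const_config (b : bool) : config := fun=> b.

End Configurations.
Arguments const_config {K} d r b.

Section Process.
Context {K : realType} {d : nat} {r : K}.
Implicit Types (U : spacetime d -> upfamily d r) (w : config d r).

(* The process up to time n, excluded; the value is irrelevant at times
   smaller than -r or at least n. *)
Fixpoint eta_before U w (n : nat) : spacetime d -> bool :=
  if n is m.+1 then fun z =>
    if z.2 == m%:Z then
      [fset y in range_fset d r | eta_before U w m (z + y)%R]%fset
        \in members (U z)
    else eta_before U w m z
  else fun z => if insub z.2 is Some s then w (z.1, s) else false.

(* eta U w (x, t) is the state of x at time t. *)
Definition eta U w (z : spacetime d) : bool := eta_before U w (absz z.2).+1 z.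

Lemma eta_before_stable U w n (z : spacetime d) :
  z.2 < n%:Z -> eta_before U w n z = eta U w z.
Proof.
have lt0 m : z.2 < 0 -> eta_before U w m z = eta_before U w 0 z.
  move=> z0; elim: m => //= m ->; case: eqP => // zm.
  by move: z0; rewrite zm; lia.
rewrite /eta; case: (ltP z.2 0) => [z0 _|z0]; first by rewrite !lt0.
elim: n => [|n IH] zn; first by lia.
have [zE|zE] := eqVneq z.2 n%:Z; first by rewrite zE.
rewrite -IH /=; last by rewrite lt_neqAle zE /= -ltzD1 -PoszD addn1.
by rewrite (negbTE zE).
Qed.

Lemma eta_init U w (x : 'rV[int]_d) (s : past r) :
  eta U w (x, \val s) = w (x, s).
Proof.
have /set_mem := valP s; rewrite /past /= in_itv /= ltrz0 => /andP[_ s0].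
rewrite -(@eta_before_stable _ _ 0) //=.
by rewrite valK.
Qed.

Lemma eta_step U w z : 0 <= z.2 ->
  eta U w z =
    ([fset y in range_fset d r | eta U w (z + y)%R]%fset \in members (U z)).
Proof.
move=> z0; rewrite {1}/eta /= gez0_abs // eqxx.
suff -> :
  [fset y in range_fset d r | eta_before U w (absz z.2) (z + y)%R]%fset =
  [fset y in range_fset d r | eta U w (z + y)%R]%fset by [].
apply/fsetP => y; rewrite !inE.
case yR : (y \in range_fset d r) => //=; apply: eta_before_stable.
move: yR; rewrite in_range_fset => /andP[_]; rewrite in_itv /= => /andP[_].
by rewrite ltrz0 /=; lia.
Qed.

Definition config_at (e : spacetime d -> bool) (t : int) : config d r :=
  fun i => e (i.1, t + \val i.2).

End Process.

Section Laws.
Context {K : realType} {d : nat} {r : K}.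

Definition has_law dT (T : measurableType dT) dT' (T' : measurableType dT')
    (P : probability T K) (X : T -> T') (mu : probability T' K) : Prop :=
  measurable_fun setT X /\ forall A, measurable A -> P (X @^-1` A) = mu A.

Definition iid_field dT (T : measurableType dT) (P : probability T K)
    (rates : probability (upfamily d r) K)
    (F : spacetime d -> {RV P >-> upfamily d r}) : Prop :=
  (forall z, has_law P (F z) rates) /\
  (forall (J : {fset spacetime d}) (A : spacetime d -> set (upfamily d r)),
    P (\bigcap_(z in [set` J]) (F z @^-1` A z)) =
    (\prod_(z <- J) P (F z @^-1` A z))%E).

(* The sigma-algebra generated by (U_{x,t})_{t >= 0} *)
Definition future dT (T : measurableType dT) (P : probability T K)
    (F : spacetime d -> {RV P >-> upfamily d r}) : set (set T) :=
  <<s [set E | exists z A, 0 <= z.2 /\ E = F z @^-1` A] >>.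

(* The initial configuration w0 has law mu and is independent of the
   up-families at nonnegative times. *)
Definition start_law dT (T : measurableType dT) (P : probability T K)
    (F : spacetime d -> {RV P >-> upfamily d r}) (w0 : T -> config d r)
    (mu : probability (config d r) K) : Prop :=
  has_law P w0 mu /\
  forall A E, measurable A -> future F E ->
    P (w0 @^-1` A `&` E) = (P (w0 @^-1` A) * P E)%E.

Definition run dT (T : measurableType dT) (P : probability T K)
    (F : spacetime d -> {RV P >-> upfamily d r}) (w0 : T -> config d r)
    (t : nat) : T -> config d r :=
  fun o => config_at (eta (fun z => F z o) (w0 o)) t%:Z.

Definition invariant_measure (rates : probability (upfamily d r) K)
    (mu : probability (config d r) K) : Prop :=
  forall dT (T : measurableType dT) (P : probability T K)
    (F : spacetime d -> {RV P >-> upfamily d r}) (w0 : T -> config d r),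
  iid_field rates F -> start_law F w0 mu ->
  forall t : nat, has_law P (run F w0 t) mu.

(* Weak convergence of laws on Omega, for the product topology *)
Definition weak_limit (mu_ : nat -> set (config d r) -> \bar K)
    (mu : set (config d r) -> \bar K) : Prop :=
  forall f : config d r -> K,
    continuous (f : {ptws coordinate d r -> bool} -> K) ->
    (exists M, forall w, `|f w| <= M) ->
    (\int[mu_ t]_w (f w)%:E @[t --> \oo] --> \int[mu]_w (f w)%:E)%E.

Definition upper_invariant_measure (rates : probability (upfamily d r) K)
    (mu : probability (config d r) K) : Prop :=
  forall dT (T : measurableType dT) (P : probability T K)
    (F : spacetime d -> {RV P >-> upfamily d r}),
  iid_field rates F ->
  weak_limit
    (fun t => pushforward P (run F (fun=> const_config d r true) t)) mu.

End Laws.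

Section BootstrapPercolation.
Context {d : nat}.
Implicit Types (X : {fset {fset spacetime d}}) (w : spacetime d -> bool).

Definition update_family X : Prop := forall A, A \in X -> 0 \notin A.

Definition bp_step X w : spacetime d -> bool :=
  fun z => w z ||
    has (fun A : {fset spacetime d} => all (fun y => w (z + y)) A) X.

(* The state of the BP at time s, started from w *)
Definition bp X w (s : nat) : spacetime d -> bool := iter s (bp_step X) w.

Definition bp_closure X w : set (spacetime d) :=
  [set z | exists s : nat, bp X w s z].

Context {K : realType}.

Definition bp_of_ca (r : K) (U : upfamily d r) : {fset {fset spacetime d}} :=
  [fset (range_fset d r `\` D)
    | D in (fpowerset (range_fset d r) `\` members U)]%fset.

Definition update_family_in_range (r : K) : set {fset {fset spacetime d}} :=
  [set X | update_family X /\
    forall A, A \in X -> (A `<=` range_fset d r)%fset].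

End BootstrapPercolation.
Arguments update_family_in_range d {K} r.

(* Main.v *)
(* Put D = {z : U_z = empty} and let C be its closure. The rules R \ A, for A not
   in U, are chosen so that z lies outside C exactly when z is not in D and the
   set of y in R with z + y outside C belongs to U; hence the complement of C is
   a trajectory of the CA with death, defined for all times, and it agrees with
   the process started from C_0. A point is put into C by finitely many rules,
   all pointing to the past, so the process started from 1 at a sufficiently
   early time -t already vanishes there, while monotonicity keeps it equal to 1 outside
   C. Since the field is i.i.d., the process at time t started from 1 at time 0
   has the law of the one at time 0 started from 1 at time -t, and so converges
   in law to C_0. Invariance follows from the independence of C_0 and the future
   together with translation invariance; any other invariant measure is
   dominated by the upper one. *)
From HB Require Import structures.
Require Import Defs.
From mathcomp Require Import all_boot all_order all_algebra finmap.
From mathcomp Require Import all_classical all_reals all_analysis.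
From mathcomp Require Import measurable_realfun zify.

Set Implicit Arguments.
Unset Strict Implicit.
Unset Printing Implicit Defensive.

Import Order.TTheory GRing.Theory Num.Theory.
Import numFieldNormedType.Exports.

Local Open Scope classical_set_scope.
Local Open Scope ring_scope.

(** * Duality between up-families and update families *)

Section UpFamilyDuality.
Context {K : realType} {d : nat} {r : K}.
Implicit Types (U : upfamily d r) (A D Z : {fset spacetime d}).

Lemma range_lt0 (y : spacetime d) : y \in range_fset d r -> y.2 < 0.
Proof.
by rewrite in_range_fset => /andP[_]; rewrite in_itv /= ltrz0 => /andP[].
Qed.

Lemma range_past (y : spacetime d) : y \in range_fset d r -> past r y.2.
Proof. by rewrite in_range_fset => /andP[]. Qed.

Lemma past_lt0 (s : past r) : \val s < 0.
Proof.
by have /set_mem := valP s; rewrite /past /= in_itv /= ltrz0 => /andP[].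
Qed.

Lemma members_sub U A : A \in members U -> (A `<=` range_fset d r)%fset.
Proof. by have /asboolP[+ _] := membersP U; apply. Qed.

Lemma members_up U A Z : A \in members U -> (A `<=` Z)%fset ->
  (Z `<=` range_fset d r)%fset -> Z \in members U.
Proof. by have /asboolP[_] := membersP U; apply. Qed.

Lemma upfamily_inj U U' : members U = members U' -> U = U'.
Proof. exact: val_inj. Qed.

Lemma bp_of_caP U A : reflect
  (exists D, [/\ (D `<=` range_fset d r)%fset, D \notin members U &
    A = (range_fset d r `\` D)%fset]) (A \in bp_of_ca U).
Proof.
apply: (iffP idP) => [/imfsetP[D /=]|[D [DR DU ->]]].
  by rewrite !inE fpowersetE => /andP[DU DR] ->; exists D.
by apply/imfsetP; exists D; rewrite //= !inE fpowersetE DU.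
Qed.

Lemma update_family_in_range_bp_of_ca U :
  update_family_in_range d r (bp_of_ca U).
Proof.
split=> A /bp_of_caP[D [_ _ ->]]; last exact: fsubsetDl.
by apply/negP; rewrite inE => /andP[_ /range_lt0]; rewrite ltxx.
Qed.

Lemma members_generated (X : {fset {fset spacetime d}}) Z :
  (Z \in members (generated r X)) =
  (Z `<=` range_fset d r)%fset && has (fun A => A `<=` Z)%fset X.
Proof. by rewrite !inE fpowersetE. Qed.

(** For [Z] in the range, a rule [range \ D] lies in [Z] iff [range \ Z] lies in [D]. As [U] is
    closed upwards, some [D] outside [U] contains [range \ Z] iff [range \ Z] is itself outside [U]:
    generation yields the Boolean dual of [U]. *)
Lemma members_generated_bp_of_ca U Z :
  (Z \in members (generated r (bp_of_ca U))) =
  (Z `<=` range_fset d r)%fset && ((range_fset d r `\` Z)%fset \notin members U).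
Proof.
rewrite members_generated; case ZR : (Z `<=` _)%fset => //=.
apply/hasP/idP => [[_ /bp_of_caP[D [DR DU ->]] DZ]|ZU]; last first.
  exists Z => //; apply/bp_of_caP; exists (range_fset d r `\` Z)%fset.
  by split=> //; [exact: fsubsetDl|rewrite fsetDK].
apply: contra DU => /members_up; apply=> //.
by rewrite fsubDset fsetUC -fsubDset.
Qed.

Lemma set_bij_bp_of_ca : set_bij [set: upfamily d r]
  [set generated r X | X in update_family_in_range d r]
  (fun U => generated r (bp_of_ca U)).
Proof.
split=> [U _|U U' _ _ eqU|_ [X [_ XR] <-]].
- by exists (bp_of_ca U) => /=; first exact: update_family_in_range_bp_of_ca.
- apply/upfamily_inj/fsetP => D.
  have [DR|] := boolP (D `<=` range_fset d r)%fset; last first.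
    by move=> DR; apply/idP/idP => /members_sub; rewrite (negbTE DR).
  have DRR : (range_fset d r `\` D `<=` range_fset d r)%fset by exact: fsubsetDl.
  have := congr1 (fun V => (range_fset d r `\` D)%fset \in members V) eqU.
  by rewrite !members_generated_bp_of_ca DRR fsetDK //= => /negb_inj.
(* Duality is an involution, so the preimage is the dual of the family generated by [X]. Complements
   reverse inclusions and the negation reverses them back, hence [M] is closed upwards. *)
- pose M := [fset D in fpowerset (range_fset d r) |
    (range_fset d r `\` D)%fset \notin members (generated r X)]%fset.
  have inM D : (D \in M) = (D `<=` range_fset d r)%fset &&
      ((range_fset d r `\` D)%fset \notin members (generated r X)).
    by rewrite !inE !fpowersetE.
  have MP : `[< is_upfamily r M >].
    apply/asboolP; split=> [D|D E]; rewrite !inM => /andP[//] DR DX DE ->; rewrite andTb.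
    apply: contra DX => EX.
    by apply: members_up EX _ _; [exact: fsetDS|exact: fsubsetDl].
  exists (UpFamily MP) => //; apply/upfamily_inj/fsetP => Z.
  rewrite members_generated_bp_of_ca.
  have [ZR|ZR] := boolP (Z `<=` range_fset d r)%fset; last first.
    by apply/esym/negbTE; apply: contra ZR => /members_sub.
  by rewrite /= inM fsubsetDl negbK fsetDK.
Qed.

End UpFamilyDuality.

(** * Deterministic dynamics *)

Section Closure.
Context {d : nat}.
Implicit Types (X : {fset {fset spacetime d}}) (v : spacetime d -> bool).
Implicit Types (z : spacetime d).

Lemma bp_le X v m n z : (m <= n)%N -> bp X v m z -> bp X v n z.
Proof.
move=> /subnKC <-; elim: (n - m)%N => [|k IH]; first by rewrite addn0.
by rewrite addnS => /IH zk; rewrite /bp iterS /bp_step [X in X || _]zk.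
Qed.

(** Rules are finite sets, so the infection times of the points [z + y] with [y] in [A] have a
    maximum, and one step later [z] is infected: the closure is a fixed point of the dynamics. *)
Lemma in_bp_closure X v z : (z \in bp_closure X v) =
  v z || has (fun A : {fset spacetime d} =>
    all (fun y => z + y \in bp_closure X v) A) X.
Proof.
apply/idP/orP => [/set_mem[s]|[vz|/hasP[A AX /allP zA]]].
- elim: s => [|s IH]; first by left.
  rewrite /bp iterS => /orP[//|/hasP[A AX /allP zA]].
  right; apply/hasP; exists A => //; apply/allP => y yA.
  by apply/mem_set; exists s; exact: zA.
- by apply/mem_set; exists 0%N.
- have zA' y : y \in A -> {s | bp X v s (z + y)}.
    by move=> /zA /set_mem /cid.
  pose t y := if insub y is Some y' then sval (zA' _ (valP (y' : A))) else 0%N.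
  have tP y : y \in A -> bp X v (t y) (z + y).
    by move=> yA; rewrite /t insubT /=; case: (zA' _ _).
  apply/mem_set; exists (\max_(y <- A) t y)%N.+1; rewrite /bp iterS.
  apply/orP; right; apply/hasP; exists A => //; apply/allP => y yA.
  by apply: bp_le (tP _ yA); exact: leq_bigmax_seq.
Qed.

Definition translate (t : int) v : spacetime d -> bool := fun z => v (z + (0, t)).

Lemma bp_translate X t v s : bp X (translate t v) s = translate t (bp X v s).
Proof.
elim: s => // s IH; rewrite /bp !iterS -/(bp _ _ _) IH; apply/funext => z.
rewrite /bp_step /translate; congr (_ || _).
by apply: eq_has => A; apply: eq_all => y; rewrite addrAC.
Qed.

Lemma bp_closure_translate X t v z :
  (z \in bp_closure X (translate t v)) = (z + (0, t) \in bp_closure X v).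
Proof.
by apply/idP/idP => /set_mem[s zs]; apply/mem_set; exists s;
  move: zs; rewrite bp_translate.
Qed.

End Closure.

Section Evolution.
Context {K : realType} {d : nat} {r : K}.
Implicit Types (U : spacetime d -> upfamily d r) (w : config d r).
Implicit Types (z : spacetime d) (e : spacetime d -> bool).

Definition neighbours e z : {fset spacetime d} :=
  [fset y in range_fset d r | e (z + y)%R]%fset.

Lemma in_neighbours e z y :
  (y \in neighbours e z) = (y \in range_fset d r) && e (z + y).
Proof. by rewrite !inE. Qed.

Lemma neighbours_sub e z : (neighbours e z `<=` range_fset d r)%fset.
Proof. by apply/fsubsetP => y; rewrite in_neighbours => /andP[]. Qed.

Lemma eq_neighbours (e e' : spacetime d -> bool) z :
  (forall y, y \in range_fset d r -> e (z + y) = e' (z + y)) ->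
  neighbours e z = neighbours e' z.
Proof.
move=> ee'; apply/fsetP => y; rewrite !in_neighbours.
by case yR: (y \in range_fset d r) => //=; exact: ee'.
Qed.

Lemma eta_neighbours U w z : 0 <= z.2 ->
  eta U w z = (neighbours (eta U w) z \in members (U z)).
Proof. exact: eta_step. Qed.

(** Points of the range have negative time, so passing from [z] to [z + y] lowers the time, which
    becomes negative after finitely many moves. *)
Lemma time_ind (Q : spacetime d -> Prop) :
  (forall z, z.2 < 0 -> Q z) ->
  (forall z, 0 <= z.2 -> (forall y, y \in range_fset d r -> Q (z + y)) -> Q z) ->
  forall z, Q z.
Proof.
move=> Q0 QS z; have [n] := ubnP `|z.2|%N; elim: n z => // n IH z zn.
case: (ltP z.2 0) => [/Q0//|z0]; apply: QS => // y /range_lt0 y0.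
case: (ltP (z + y).2 0) => [/Q0//|]; rewrite /= => zy0; apply: IH => /=; lia.
Qed.

Lemma eta_in_past U w z (zp : past r z.2) : eta U w z = w (z.1, SigSub (mem_set zp)).
Proof. by case: z zp => x s zp; rewrite -(eta_init U). Qed.

Lemma eta_before_past U w z : z.2 < 0 -> ~ past r z.2 -> eta U w z = false.
Proof.
move=> z0 zp; rewrite -(eta_before_stable U w (n := 0)) //=.
by case: insubP => // s /set_mem.
Qed.

Lemma eta_lt0 U U' w z : z.2 < 0 -> eta U w z = eta U' w z.
Proof. by move=> z0; rewrite -!(eta_before_stable _ w (n := 0)). Qed.

Lemma eq_eta U U' w : (forall z, 0 <= z.2 -> U z = U' z) ->
  eta U w =1 eta U' w.
Proof.
move=> UU'; apply: time_ind => [z /eta_lt0|z z0 IH]; first exact.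
by rewrite !eta_neighbours // UU' // (eq_neighbours IH).
Qed.

(** Times below [- r] are excluded because [eta] has the default value [false] there while [e] is
    arbitrary. Neighbours of a point of nonnegative time never fall below [- r], so the induction
    stays within the allowed times. *)
Lemma eta_unique U w e :
  (forall x (s : past r), e (x, \val s) = w (x, s)) ->
  (forall z, 0 <= z.2 ->
    e z = (neighbours e z \in members (U z))) ->
  forall z, past r z.2 \/ 0 <= z.2 -> eta U w z = e z.
Proof.
move=> e0 eS; apply: time_ind => [z z0 [zp|]|z z0 IH _].
- by rewrite (eta_in_past _ _ zp) -e0; case: z {z0} zp.
- by rewrite leNgt z0.
- rewrite eta_neighbours // eS // (eq_neighbours (e' := e)) // => y yR; apply: IH => //.
  case: (ltP (z + y).2 0) => zy0; [left|by right].
  have := range_past yR; rewrite /past /= !in_itv /= !ltrz0 => /andP[ry _].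
  by rewrite zy0 andbT (le_trans ry) // ler_int /=; lia.
Qed.

(** Attractiveness: an up-family turns the inclusion of neighbour sets into the ordering of the new
    states. *)
Lemma eta_mono U w w' z : (forall i, w i -> w' i) -> eta U w z -> eta U w' z.
Proof.
move=> ww'; move: z; apply: time_ind => [z z0|z z0 IH].
  have [zp|zp] := pselect (past r z.2); last by rewrite eta_before_past.
  by rewrite !(eta_in_past _ _ zp); exact: ww'.
rewrite !eta_neighbours // => /members_up; apply; last exact: neighbours_sub.
apply/fsubsetP => y; rewrite !in_neighbours => /andP[yR ey].
by rewrite yR /=; exact: IH.
Qed.

End Evolution.

Lemma past_shift {K : realType} {r : K} (s : past r) (t : nat) :
  past r (t%:Z + \val s) \/ 0 <= t%:Z + \val s.
Proof.
case: (leP 0 (t%:Z + \val s)) => [|ts0]; [by right|left].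
have /set_mem := valP s; rewrite /past /= !in_itv /= !ltrz0 => /andP[rs _].
by rewrite ts0 andbT (le_trans rs) // ler_int lerDr.
Qed.

(** * The automaton with death and its dual closure *)

Section Death.
Context {K : realType} {d : nat} {r : K}.
Variable U : upfamily d r.
Implicit Types (v : spacetime d -> bool) (z : spacetime d).

(** The up-family field rebuilt from a Boolean field of deaths; it agrees almost surely with the
    i.i.d. field, which reduces the process to a function of the deaths and the initial
    configuration. *)
Definition with_death v z : upfamily d r := if v z then empty_upfamily d r else U.

Local Notation closure v := (bp_closure (bp_of_ca U) v).

(** This is C_0 when [v] is the death field. *)
Definition survivors v : config d r := fun i => (i.1, \val i.2) \notin closure v.

(* If the set [A] of uninfected neighbours is not in [U], the complement of [A]
   is one of the update rules and infects [z]; if it is in [U], every rule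
   [R \ D] with [D] not in [U] misses some point of [A]. *)
Lemma notin_closure v z : (z \notin closure v) =
  (neighbours (r := r) (fun z => z \notin closure v) z
    \in members (with_death v z)).
Proof.
rewrite in_bp_closure /with_death negb_or.
case: (v z) => /=; first by rewrite inE.
set A := neighbours _ _; have AR : (A `<=` range_fset d r)%fset.
  exact: neighbours_sub.
apply/hasPn/idP => [H|AU B /bp_of_caP[D [DR DU ->]]].
- apply: contraT => AU.
  have /H/negP[] : (range_fset d r `\` A)%fset \in bp_of_ca U.
    by apply/bp_of_caP; exists A.
  by apply/allP => y; rewrite in_fsetD in_neighbours => /andP[+ yR]; rewrite yR negbK.
- apply: contra DU => /allP zD; apply: members_up AU _ DR.
  apply/fsubsetP => y; rewrite in_neighbours => /andP[yR]; apply: contraR => yD.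
  by apply: zD; rewrite in_fsetD yD.
Qed.

Lemma eta_survivors v z : past r z.2 \/ 0 <= z.2 ->
  eta (with_death v) (survivors v) z = (z \notin closure v).
Proof.
by apply: (eta_unique (e := fun z => z \notin closure v)) => // y _;
  exact: notin_closure.
Qed.

(** Induction on the number of steps that infect [z]. A point infected at the start has the empty
    up-family. If the rule [range \ D] infects [z], then for large [t] the neighbours in state 1 all
    lie in [D], which is not in [U]. *)
Lemma eta_killed v z w : z \in closure v -> exists N : nat, forall t : nat,
  (N <= t)%N -> eta (with_death (translate (- t%:Z) v)) w (z + (0, t%:Z)) = false.
Proof.
move=> /set_mem[s]; elim: s z => [|s IH] z.
  rewrite /bp /= => vz; exists `|z.2|%N => t zt.
  rewrite eta_neighbours /=; last by lia.
  rewrite /with_death /translate -addrA.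
  have -> : (0, t%:Z) + (0, - t%:Z) = 0 :> spacetime d.
    by congr pair; rewrite /= ?addr0 ?subrr.
  by rewrite addr0 vz inE.
rewrite /bp iterS => /orP[|/hasP[A /bp_of_caP[D [DR DU ->]]] /allP zD].
  exact: IH.
have zN y : y \in (range_fset d r `\` D)%fset -> {N : nat | forall t : nat,
    (N <= t)%N ->
    eta (with_death (translate (- t%:Z) v)) w (z + y + (0, t%:Z)) = false}.
  by move=> /zD/IH/cid.
pose N y := if insub y is Some y' then
  sval (zN _ (valP (y' : (range_fset d r `\` D)%fset))) else 0%N.
(* The bound by the absolute value of [z.2] makes the shifted time nonnegative, where the update
   rule applies; the maximum handles all points of the rule at once. *)
exists (maxn `|z.2| (\max_(y <- (range_fset d r `\` D)%fset) N y))%N => t.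
rewrite geq_max => /andP[zt Nt]; apply/negbTE; apply: contra DU.
rewrite eta_neighbours /=; last by lia.
rewrite /with_death; case: ifP => _; first by rewrite inE.
move=> /members_up; apply=> //; apply/fsubsetP => y; rewrite in_neighbours => /andP[yR].
apply: contraLR => yD; rewrite addrAC.
have yRD : y \in (range_fset d r `\` D)%fset by rewrite inE yD.
have : (N y <= t)%N by apply: leq_trans Nt; exact: leq_bigmax_seq.
by rewrite /N insubT /=; case: (zN _ _) => /= n nP /nP ->.
Qed.

End Death.

(** * Generated sigma-algebras and laws of binary fields *)

Section Probability.
Context {K : realType}.

Lemma ae_forall_count dT (T : measurableType dT) (P : probability T K)
    (I : countType) (Q : I -> T -> Prop) :
  (forall i, {ae P, forall o, Q i o}) -> {ae P, forall o, forall i, Q i o}.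
Proof.
move=> aeQ.
have : {ae P, forall o, forall n, if @choice.unpickle I n is Some i then Q i o else True}.
  by apply: ae_foralln => n; case: (choice.unpickle n) => [i|]; [exact: aeQ|exact: aeW].
by apply: filterS => o Qo i; have := Qo (choice.pickle i); rewrite choice.pickleK.
Qed.

Lemma probability_ae_eq dT (T : measurableType dT) (P : probability T K)
    (A B : set T) : measurable A -> measurable B ->
  {ae P, forall o, A o <-> B o} -> P A = P B.
Proof.
move=> mA mB [N [mN N0 ABN]].
have le (A' B' : set T) : measurable A' -> measurable B' ->
    A' `<=` B' `|` N -> (P A' <= P B')%E.
  move=> mA' mB' sub; rewrite -[leRHS]adde0 -N0.
  apply: le_trans (measureU2 _ mB' mN).
  by apply: le_measure => //; rewrite inE //; exact: measurableU.
have AB o : ~ N o -> (A o <-> B o) by move=> No; apply: contrapT => /ABN.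
by apply/eqP; rewrite eq_le; apply/andP; split; apply: le => // o h;
  have [No|/AB[ab ba]] := pselect (N o); by [right|left; auto].
Qed.

Definition rv_of dT (T : measurableType dT) (P : probability T K)
    dS (S : measurableType dS) (X : T -> S) (mX : measurable_fun setT X) :
  {RV P >-> S} := HB.pack X (isMeasurableFun.Build _ _ _ _ X mX).

(** As functions of [A], both sides are finite measures: [P] restricted to [B], and [P] scaled by
    [P B]. They agree on the pi-system [G], hence on the sigma-algebra that it generates. *)
Lemma indep_generated dT (T : measurableType dT) (P : probability T K)
    (G : set (set T)) (B : set T) :
  G `<=` measurable -> setI_closed G -> G setT -> measurable B ->
  (forall A, G A -> P (A `&` B) = P A * P B)%E ->
  (forall A, <<s G >> A -> P (A `&` B) = P A * P B)%E.
Proof.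
move=> Gm GI GT mB indep A sA.
have PB : P B = (fine (P B))%:E by rewrite fineK // fin_num_measure.
have PB0 : 0 <= fine (P B) by rewrite fine_ge0.
rewrite muleC {1}PB.
apply: (g_sigma_algebra_measure_unique G Gm (fun=> setT) (fun=> GT) _
  (mrestr P mB) (mscale (NngNum PB0) P)) => //.
- by rewrite bigcup_const.
- by move=> C GC /=; rewrite /mscale /mrestr /= muleC -PB; exact: indep.
- by move=> k; rewrite /mrestr ltey_eq fin_num_measure //; exact: measurableI.
Qed.

(** One side is extended at a time: first [H] with a member of [G] fixed, then [G] with an event
    generated by [H] fixed. *)
Lemma indep_generated2 dT (T : measurableType dT) (P : probability T K)
    (G H : set (set T)) :
  G `<=` measurable -> setI_closed G -> G setT ->
  H `<=` measurable -> setI_closed H -> H setT ->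
  (forall A B, G A -> H B -> P (A `&` B) = P A * P B)%E ->
  (forall A B, <<s G >> A -> <<s H >> B -> P (A `&` B) = P A * P B)%E.
Proof.
move=> Gm GI GT Hm HI HT indep A B GA HB.
have mB : measurable B.
  by move: HB; apply: smallest_sub => //; exact: sigma_algebra_measurable.
apply: (indep_generated Gm GI GT mB _ GA) => {A GA} A GA.
have mA := Gm _ GA.
rewrite setIC muleC; apply: (indep_generated Hm HI HT mA _ HB) => C HC.
by rewrite setIC muleC indep.
Qed.

End Probability.

Section MeasurableBool.
Context {dT} {T : measurableType dT}.

Lemma measurable_all (I : Type) (s : seq I) (b : T -> I -> bool) :
  (forall i, measurable_fun setT (b ^~ i)) ->
  measurable_fun setT (fun o => all (b o) s).
Proof. by move=> mb; elim: s => //= i s IH; exact: measurable_and. Qed.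

Lemma measurable_all_in (I : eqType) (s : seq I) (b : T -> I -> bool) :
  (forall i, i \in s -> measurable_fun setT (b ^~ i)) ->
  measurable_fun setT (fun o => all (b o) s).
Proof.
elim: s => //= i s IH mb; apply: measurable_and; first by apply: mb; rewrite inE eqxx.
by apply: IH => j js; apply: mb; rewrite inE js orbT.
Qed.

Lemma measurable_has_in (I : eqType) (s : seq I) (b : T -> I -> bool) :
  (forall i, i \in s -> measurable_fun setT (b ^~ i)) ->
  measurable_fun setT (fun o => has (b o) s).
Proof.
elim: s => //= i s IH mb; apply: measurable_or; first by apply: mb; rewrite inE eqxx.
by apply: IH => j js; apply: mb; rewrite inE js orbT.
Qed.

Lemma measurable_fun_boolP (b : T -> bool) :
  measurable_fun setT b <-> measurable [set o | b o].
Proof.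
split=> [mb|mb].
  by rewrite -[X in measurable X]setTI; exact: (mb measurableT [set true]).
by apply: (measurable_fun_bool true); rewrite setTI.
Qed.

End MeasurableBool.

(** * Boolean fields with the product sigma-algebra *)

Section Fields.
Variable I : choiceType.

(** With index set [coordinate d r] this is the sigma-algebra of [config d r], so the results serve
    both configurations and death fields. *)
Definition cylinder_sets : set (set (I -> bool)) :=
  [set [set w : I -> bool | w i] | i in setT].

Definition field : Type := g_sigma_algebraType cylinder_sets.
HB.instance Definition _ := Measurable.on field.

Lemma measurable_field dT (T : measurableType dT) (X : T -> field) :
  (forall i, measurable_fun setT (fun o => X o i)) -> measurable_fun setT X.
Proof.
move=> mX; apply: (@measurability _ _ T field setT X cylinder_sets) => //.
move=> _ [_ [i _ <-] <-].
by rewrite setTI; exact/measurable_fun_boolP.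
Qed.

Lemma measurable_eval i : measurable_fun setT (fun w : field => w i).
Proof.
by apply/measurable_fun_boolP; apply: sub_sigma_algebra; exists i.
Qed.

Lemma measurable_fieldP dT (T : measurableType dT) (X : T -> field) i :
  measurable_fun setT X -> measurable_fun setT (fun o => X o i).
Proof. by move=> mX; apply: measurableT_comp (measurable_eval i) mX. Qed.

(** The events that all sites of a finite set have value 1 form a generating pi-system, intersection
    corresponding to the union of the finite sets. Events with sites of value 0 need not be
    compared. *)
Lemma field_law_unique (K : realType)
    dT (T : measurableType dT) (P : probability T K) (X : T -> field)
    dT' (T' : measurableType dT') (P' : probability T' K) (X' : T' -> field) :
  measurable_fun setT X -> measurable_fun setT X' ->
  (forall J : {fset I},
    P [set o | all (X o) J] = P' [set o | all (X' o) J]) ->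
  forall A, measurable A -> P (X @^-1` A) = P' (X' @^-1` A).
Proof.
move=> mX mX' eqJ A mA.
pose G := [set [set w : field | all w J] | J in [set: {fset I}]].
have mG : G `<=` measurable.
  move=> _ [J _ <-]; apply/measurable_fun_boolP/measurable_all => i.
  exact: measurable_eval.
apply: (g_sigma_algebra_measure_unique (G : set (set field)) mG (fun=> setT) _ _
  (distribution P (rv_of P mX)) (distribution P' (rv_of P' mX'))) => //.
- by move=> _; exists fset0 => //; apply/seteqP; split=> // w _ /=; apply/allP.
- by rewrite bigcup_const.
- move=> _ _ [J _ <-] [J' _ <-]; exists (J `|` J')%fset => //.
  apply/seteqP; split=> w /=.
    move=> /allP wJ; split; apply/allP => i iJ; apply: wJ; rewrite inE iJ //.
    by rewrite orbT.
  by move=> [/allP wJ /allP wJ']; apply/allP => i; rewrite inE => /orP[/wJ|/wJ'].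
- by move=> _ [J _ <-]; exact: eqJ.
- by move=> k; rewrite ltey_eq fin_num_measure.
- move: A mA; apply: smallest_sub; first exact: smallest_sigma_algebra.
  move=> _ [i _ <-]; apply: sub_sigma_algebra; exists [fset i]%fset => //.
  apply/seteqP; split=> w /=; first by move=> /allP; apply; rewrite inE.
  by move=> wi; apply/allP => j; rewrite inE => /eqP ->.
Qed.

End Fields.

(** * Measurability and the law of the death field *)

Section Measurability.
Context {K : realType} {d : nat} {r : K} {dT} {T : measurableType dT}.

Lemma measurable_upfamily dS (S : measurableType dS) (g : upfamily d r -> S) :
  measurable_fun setT g.
Proof. by []. Qed.

Lemma measurable_config (w : T -> config d r) :
  (forall i, measurable_fun setT (fun o => w o i)) -> measurable_fun setT w.
Proof. exact: (@measurable_field (coordinate d r)). Qed.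

Lemma measurable_coordinate (w : T -> config d r) i :
  measurable_fun setT w -> measurable_fun setT (fun o => w o i).
Proof. exact: (@measurable_fieldP (coordinate d r)). Qed.

Lemma measurable_eta (F : T -> spacetime d -> upfamily d r) (w : T -> config d r) z :
  (forall z, measurable_fun setT (F ^~ z)) -> measurable_fun setT w ->
  measurable_fun setT (fun o => eta (F o) (w o) z).
Proof.
move=> mF mw; elim/(@time_ind K d r): z => [z z0|z z0 IH].
  have [zp|zp] := pselect (past r z.2).
    rewrite (_ : (fun _ => _) = fun o => w o (z.1, SigSub (mem_set zp))).
      exact: measurable_coordinate.
    by apply/funext => o; exact: eta_in_past.
  rewrite (_ : (fun _ => _) = cst false) //.
  by apply/funext => o; rewrite eta_before_past.
pose nb o := neighbours (r := r) (eta (F o) (w o)) z.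
(* The neighbour set takes finitely many values, the subsets of the range, so the event is a finite
   union over its value [S]. *)
rewrite (_ : (fun _ => _) = fun o =>
    has (fun S => (S \in members (F o z)) && (nb o == S)) (fpowerset (range_fset d r))).
  apply: measurable_has_in => S; rewrite fpowersetE => SR; apply: measurable_and.
    exact: (measurableT_comp
      (measurable_upfamily (fun V => S \in members V)) (mF z)).
  rewrite (_ : (fun _ => _) = fun o =>
      all (fun y => eta (F o) (w o) (z + y) == (y \in S)) (range_fset d r)).
    apply: measurable_all_in => y yR.
    case: (y \in S).
      by under eq_fun do rewrite eqb_id; exact: IH.
    by under eq_fun do rewrite eqbF_neg; apply: measurable_neg; exact: IH.
  apply/funext => o; apply/eqP/allP => [<- y yR|H].
    by rewrite in_neighbours yR eqxx.
  apply/fsetP => y; rewrite in_neighbours.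
  have [yR|yR] := boolP (y \in range_fset d r); first exact/eqP/H.
  by apply/esym/negbTE; apply: contra yR; apply: fsubsetP SR y.
apply/funext => o; rewrite eta_neighbours //.
apply/idP/hasP => [nbF|[S _ /andP[SF /eqP nbS]]]; last by rewrite -/(nb o) nbS.
by exists (nb o); rewrite ?nbF ?eqxx // fpowersetE neighbours_sub.
Qed.

Lemma measurable_config_at (e : T -> spacetime d -> bool) (t : int) :
  (forall z, measurable_fun setT (e ^~ z)) ->
  measurable_fun setT (fun o => config_at (r := r) (e o) t).
Proof. by move=> me; apply: measurable_config => i; exact: me. Qed.

Lemma measurable_with_death (U : upfamily d r) (v : T -> spacetime d -> bool) z :
  measurable_fun setT (v ^~ z) -> measurable_fun setT (fun o => with_death U (v o) z).
Proof. by move=> mv; exact: measurable_fun_ifT. Qed.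

(* The rules of a CA point to the past, so that the closure before time [t0] only
   depends on the initial infections before time [t0]. *)
Lemma measurable_closure (U : upfamily d r) (v : T -> spacetime d -> bool) (t0 : int) :
  (forall z : spacetime d, z.2 < t0 -> measurable_fun setT (v ^~ z)) ->
  forall z : spacetime d, z.2 < t0 ->
    measurable_fun setT (fun o => z \in bp_closure (bp_of_ca U) (v o)).
Proof.
move=> mv.
have mbp s (z : spacetime d) : z.2 < t0 ->
    measurable_fun setT (fun o => bp (bp_of_ca U) (v o) s z).
  elim: s z => [|s IH] z zt; first exact: mv.
  apply: measurable_or; first exact: IH.
  apply: measurable_has_in => A /bp_of_caP[D [_ _ ->]].
  apply: measurable_all_in => y; rewrite inE => /andP[_ /range_lt0 y0].
  by apply: IH => /=; lia.
move=> z zt; apply/measurable_fun_boolP.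
rewrite (_ : [set _ | _] = \bigcup_s [set o | bp (bp_of_ca U) (v o) s z]).
  by apply: bigcupT_measurable => s; exact/measurable_fun_boolP/mbp.
by apply/seteqP; split=> o /=; rewrite inE => -[s]; exists s.
Qed.

(** Asking only for the deaths at negative times is what later makes C_0 measurable for the
    sigma-algebra of the past. *)
Lemma measurable_survivors (U : upfamily d r) (v : T -> spacetime d -> bool) :
  (forall z : spacetime d, z.2 < 0 -> measurable_fun setT (v ^~ z)) ->
  measurable_fun setT (fun o => survivors U (v o)).
Proof.
move=> mv; apply: measurable_config => i; apply: measurable_neg.
by apply: measurable_closure mv _ _; exact: past_lt0.
Qed.

End Measurability.

Section DeathField.
Context {K : realType} {d : nat} {r : K}.
Variables (U : upfamily d r) (p : K) (rates : probability (upfamily d r) K).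
Hypothesis hrates : forall A : set (upfamily d r),
  rates A = (p%:E * \d_U A + (1 - p)%:E * \d_(empty_upfamily d r) A)%E.

Definition dead dT (T : measurableType dT) (P : probability T K)
    (F : spacetime d -> {RV P >-> upfamily d r}) (o : T) : field (spacetime d) :=
  fun z => F z o == empty_upfamily d r.

Section OneField.
Context dT (T : measurableType dT) (P : probability T K).
Variable F : spacetime d -> {RV P >-> upfamily d r}.

Lemma measurable_up z : measurable_fun setT (F z).
Proof. exact: measurable_funP. Qed.

Lemma measurable_dead z : measurable_fun setT (fun o => dead F o z).
Proof.
exact: (measurableT_comp
  (measurable_upfamily (fun V => V == empty_upfamily d r)) (measurable_up z)).
Qed.

Hypothesis hF : iid_field rates F.

(** The rates charge only [U] and the empty up-family, and space-time is countable, so the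
    exceptional null sets can be united. *)
Lemma ae_with_death : {ae P, forall o, forall z, F z o = with_death U (dead F o) z}.
Proof.
apply: ae_forall_count => z.
pose A := [set V | V <> U /\ V <> empty_upfamily d r].
exists (F z @^-1` A); split.
- by rewrite -[X in measurable X]setTI; exact: measurable_up.
- rewrite (hF.1 z).2 // hrates !diracE.
  by rewrite !memNset ?mule0 ?adde0 //= => -[].
- move=> o /= Fo; split=> Fz; apply: Fo; rewrite /with_death /dead Fz ?eqxx //.
  by case: eqP.
Qed.

End OneField.

(** A finite set of sites is entirely dead with probability [c] to the power of its cardinality,
    where [c] is the mass of the empty up-family. This depends neither on the shift nor on the
    probability space. *)
Lemma dead_law dT (T : measurableType dT) (P : probability T K)
    (F : spacetime d -> {RV P >-> upfamily d r})
    dT' (T' : measurableType dT') (P' : probability T' K)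
    (F' : spacetime d -> {RV P' >-> upfamily d r}) (t : int) :
  iid_field rates F -> iid_field rates F' ->
  forall A : set (field (spacetime d)), measurable A ->
    P ((fun o => translate t (dead F o)) @^-1` A) = P' (dead F' @^-1` A).
Proof.
move=> hF hF'; apply: field_law_unique.
- by apply: measurable_field => z; exact: measurable_dead.
- by apply: measurable_field => z; exact: measurable_dead.
move=> J; pose c := rates [set empty_upfamily d r].
pose tr (z : spacetime d) : spacetime d := z + (0, t).
transitivity (\prod_(z <- J) c)%E.
- transitivity (\prod_(z <- [fset tr z | z in J]%fset) c)%E; last first.
    rewrite big_imfset //= => y z _ _; exact: addIr.
  rewrite -(eq_bigr _ (fun z _ => (hF.1 z).2 [set empty_upfamily d r] I)) -hF.2.
  congr (P _); apply/seteqP; split=> o /=.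
    move=> /allP oJ _ /imfsetP[z zJ ->] /=; exact/eqP/oJ.
  move=> oJ; apply/allP => z zJ; apply/eqP/(oJ (tr z)) => /=.
  by apply/imfsetP; exists z.
- rewrite -(eq_bigr _ (fun z _ => (hF'.1 z).2 [set empty_upfamily d r] I)) -hF'.2.
  congr (P' _); apply/seteqP; split=> o /=.
    by move=> oJ; apply/allP => z zJ; apply/eqP; exact: oJ.
  by move=> /allP oJ z /oJ /eqP.
Qed.

Lemma dead_translate dT (T : measurableType dT) (P : probability T K)
    (F : spacetime d -> {RV P >-> upfamily d r}) (t : int) :
  iid_field rates F ->
  forall A : set (field (spacetime d)), measurable A ->
    P ((fun o => translate t (dead F o)) @^-1` A) = P (dead F @^-1` A).
Proof. by move=> hF; exact: dead_law. Qed.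

Lemma dead_law_unique dT (T : measurableType dT) (P : probability T K)
    (F : spacetime d -> {RV P >-> upfamily d r})
    dT' (T' : measurableType dT') (P' : probability T' K)
    (F' : spacetime d -> {RV P' >-> upfamily d r}) :
  iid_field rates F -> iid_field rates F' ->
  forall A : set (field (spacetime d)), measurable A ->
    P (dead F @^-1` A) = P' (dead F' @^-1` A).
Proof.
by move=> hF hF' A mA; rewrite -(dead_translate 0 hF mA); exact: dead_law.
Qed.

End DeathField.

(** * Independence of past and future *)

Section Independence.
Context {K : realType} {d : nat} {r : K} {rates : probability (upfamily d r) K}.
Context {dT} {T : measurableType dT} {P : probability T K}.
Context {F : spacetime d -> {RV P >-> upfamily d r}}.
Hypothesis hF : iid_field rates F.

(* Extending the constraints by [setT] outside of a finite set makes intersections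
   and products of probabilities pointwise in [z]. *)
Definition local_events (Q : spacetime d -> Prop) : set (set T) :=
  [set E | exists (J : {fset spacetime d}) (A : spacetime d -> set (upfamily d r)),
    (forall z, z \notin J \/ ~ Q z -> A z = setT) /\
    E = [set o | forall z, A z (F z o)]].

Lemma local_events1 (Q : spacetime d -> Prop) z A : Q z ->
  local_events Q (F z @^-1` A).
Proof.
move=> Qz; exists [fset z]%fset, (fun y => if y == z then A else setT); split.
  by move=> y; rewrite inE; case: eqP => // -> [].
apply/seteqP; split=> o /= => [Ao y|/(_ z)]; last by rewrite eqxx.
by case: eqP => // ->.
Qed.

Lemma local_eventsT Q : local_events Q setT.
Proof. by exists fset0, (fun=> setT); split => //; apply/seteqP; split. Qed.

Lemma local_eventsI Q : setI_closed (local_events Q).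
Proof.
move=> _ _ [J [A [JA ->]]] [J' [A' [JA' ->]]].
exists (J `|` J')%fset, (fun z => A z `&` A' z); split.
  move=> z; rewrite inE negb_or => -[/andP[zJ zJ']|Qz].
    by rewrite JA ?JA' ?setIT //; left.
  by rewrite JA ?JA' ?setIT //; right.
apply/seteqP; split=> o /=; first by move=> [oA oA'] z; split.
by move=> oAA'; split=> z; have [] := oAA' z.
Qed.

(** The set [L] may exceed the set of constrained sites, so two events can be written as products
    over a common set. *)
Lemma probability_local (L : {fset spacetime d}) (A : spacetime d -> set (upfamily d r)) :
  (forall z, z \notin L -> A z = setT) ->
  P [set o | forall z, A z (F z o)] = (\prod_(z <- L) P (F z @^-1` A z))%E.
Proof.
move=> LA; rewrite -hF.2; congr (P _); apply/seteqP; split=> o /=.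
  by move=> Ao z _; exact: Ao.
move=> Ao z; have [/Ao//|/LA->//] := boolP (z \in L).
Qed.

Lemma measurable_local_events Q : local_events Q `<=` measurable.
Proof.
move=> _ [J [A [JA ->]]].
rewrite (_ : [set _ | _] = \bigcap_(z in [set` J]) (F z @^-1` A z)).
  apply: fin_bigcap_measurable => // z _.
  by rewrite -[X in measurable X]setTI; exact: measurable_up.
apply/seteqP; split=> o /= Ao z; first by move=> _; exact: Ao.
have [/Ao//|zJ] := boolP (z \in J); by rewrite JA //; left.
Qed.

Lemma indep_local Q Q' : (forall z, Q z -> Q' z -> False) ->
  forall E E', <<s local_events Q >> E -> <<s local_events Q' >> E' ->
    (P (E `&` E') = P E * P E')%E.
Proof.
move=> QQ'; apply: indep_generated2; do ?[exact: measurable_local_events|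
  exact: local_eventsI|exact: local_eventsT].
move=> _ _ [J [A [JA ->]]] [J' [A' [JA' ->]]].
rewrite (probability_local (L := (J `|` J')%fset) (A := A)); last first.
  by move=> z; rewrite inE negb_or => /andP[zJ _]; apply: JA; left.
rewrite (probability_local (L := (J `|` J')%fset) (A := A')); last first.
  by move=> z; rewrite inE negb_or => /andP[_ zJ']; apply: JA'; left.
rewrite -big_split /=.
rewrite (_ : _ `&` _ = [set o | forall z, (A z `&` A' z) (F z o)]); last first.
  apply/seteqP; split=> o /=; first by move=> [oA oA'] z; split.
  by move=> oAA'; split=> z; have [] := oAA' z.
rewrite (probability_local (L := (J `|` J')%fset)
  (A := fun z => A z `&` A' z)); last first.
  move=> z; rewrite inE negb_or => /andP[zJ zJ'].
  by rewrite JA ?JA' ?setIT //; left.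
(* Since [Q] and [Q'] exclude each other, at each site at least one of the two constraints is [setT]
   and contributes a factor 1. *)
apply: eq_bigr => z _; have [Qz|Qz] := pselect (Q z).
  rewrite (JA' z); last by right => /(QQ' _ Qz).
  by rewrite setIT preimage_setT probability_setT mule1.
rewrite (JA z); last by right.
by rewrite setTI preimage_setT probability_setT mul1e.
Qed.

Lemma future_local E : future F E -> <<s local_events (fun z => 0 <= z.2) >> E.
Proof.
apply: smallest_sub; first exact: smallest_sigma_algebra.
by move=> _ [z [A [z0 ->]]]; apply: sub_sigma_algebra; exact: local_events1.
Qed.

Lemma survivors_past (U : upfamily d r) (A : set (config d r)) : measurable A ->
  <<s local_events (fun z => z.2 < 0) >>
    ((fun o => survivors U (dead F o)) @^-1` A).
Proof.
(* [S] is the sample space with the coarser sigma-algebra of the past; the claim is measurability on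
   [S]. *)
pose S := g_sigma_algebraType (local_events (fun z => z.2 < 0)).
have mS : measurable_fun setT (fun o : S => survivors U (dead F o)).
  apply: measurable_survivors => z z0; apply/measurable_fun_boolP.
  apply: sub_sigma_algebra.
  rewrite (_ : [set _ | _] = F z @^-1` [set empty_upfamily d r]).
    exact: local_events1.
  by apply/seteqP; split=> o /= /eqP.
by move=> mA; rewrite -[X in smallest _ _ X]setTI; exact: mS.
Qed.

Lemma measurable_initial (U : upfamily d r) :
  measurable_fun setT (fun o => survivors U (dead F o)).
Proof. by apply: measurable_survivors => z _; exact: measurable_dead. Qed.

Definition survivors_law (U : upfamily d r) : probability (config d r) K :=
  distribution P (rv_of P (measurable_initial U)).

Lemma start_law_survivors (U : upfamily d r) :
  start_law F (fun o => survivors U (dead F o)) (survivors_law U).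
Proof.
split; first by split=> //; exact: measurable_initial.
move=> A E mA fE; apply: (indep_local (Q := fun z => z.2 < 0) _ _ (future_local fE)).
  by move=> z z0; rewrite leNgt z0.
exact: survivors_past.
Qed.

Lemma measurable_run (w0 : T -> config d r) t : measurable_fun setT w0 ->
  measurable_fun setT (run F w0 t).
Proof.
by move=> mw; apply: measurable_config_at => z; exact: measurable_eta.
Qed.

End Independence.

Section Glue.
Context {K : realType} {d : nat} {r : K}.
Implicit Types (w : config d r) (v : spacetime d -> bool).

(* The initial configuration at negative times and the deaths at nonnegative times
   form one field on space-time, whose law determines that of the process. The
   value [false] at times before [-r] is irrelevant. *)
Definition glue w v : field (spacetime d) := fun z =>
  if z.2 < 0 then (if insub z.2 is Some s then w (z.1, s) else false) else v z.

Definition glued_past (u : spacetime d -> bool) : config d r :=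
  fun i => u (i.1, \val i.2).

Lemma glue_past w v : glued_past (glue w v) = w.
Proof. by apply/funext => -[x s]; rewrite /glued_past /glue past_lt0 valK. Qed.

Lemma eta_glue (U : upfamily d r) w v :
  eta (with_death U (glue w v)) w =1 eta (with_death U v) w.
Proof. by apply: eq_eta => z z0; rewrite /with_death /glue ltNge z0. Qed.

End Glue.

(** * The law of the process as a function of its initial law *)

Section RunLaw.
Context {K : realType} {d : nat} {r : K}.
Variables (U : upfamily d r) (p : K) (rates : probability (upfamily d r) K).
Hypothesis hrates : forall A : set (upfamily d r),
  rates A = (p%:E * \d_U A + (1 - p)%:E * \d_(empty_upfamily d r) A)%E.

Section OneRun.
Context dT (T : measurableType dT) (P : probability T K).
Variables (F : spacetime d -> {RV P >-> upfamily d r}) (w0 : T -> config d r).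
Hypothesis hF : iid_field rates F.

Lemma ae_run t : {ae P, forall o,
  run F w0 t o = config_at (eta (with_death U (dead F o)) (w0 o)) t%:Z}.
Proof.
have := ae_with_death hrates hF; apply: filterS => o Fo.
by rewrite /run; congr (config_at (eta _ _) _); apply/funext.
Qed.

Lemma ae_survivors_law : {ae P, forall o, forall (t : nat) (x : 'rV[int]_d),
  eta (fun z => F z o) (survivors U (dead F o)) (x, t%:Z) =
  ((x, t%:Z) \notin bp_closure (bp_of_ca U) (dead F o))}.
Proof.
have := ae_with_death hrates hF; apply: filterS => o Fo t x.
rewrite -(eta_survivors U (dead F o)) /=; last by right.
by apply: eq_eta => z _; exact: Fo.
Qed.

Lemma measurable_death_run t : measurable_fun setT w0 ->
  measurable_fun setT
    (fun o => config_at (r := r) (eta (with_death U (dead F o)) (w0 o)) t%:Z).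
Proof.
move=> mw; apply: measurable_config_at => z; apply: measurable_eta => // y.
by apply: measurable_with_death; exact: measurable_dead.
Qed.

Lemma run_deathE t A : measurable_fun setT w0 -> measurable A ->
  P (run F w0 t @^-1` A) =
  P ((fun o => config_at (eta (with_death U (dead F o)) (w0 o)) t%:Z) @^-1` A).
Proof.
move=> mw mA; apply: probability_ae_eq.
- by rewrite -[X in measurable X]setTI; exact: measurable_run.
- by rewrite -[X in measurable X]setTI; exact: measurable_death_run.
- by have := ae_run t; apply: filterS => o /= ->.
Qed.

Lemma measurable_glue : measurable_fun setT w0 ->
  measurable_fun setT (fun o => glue (w0 o) (dead F o)).
Proof.
move=> mw; apply: measurable_field => z; rewrite /glue.
case: (z.2 < 0); last exact: measurable_dead.
by case: (insub z.2) => [s|] //; exact: measurable_coordinate.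
Qed.

(** The sites of [J] at negative times concern only the initial configuration, the others only the
    future deaths, and these are independent. The filler [xpredT] is never read, because of the
    guard on the time. *)
Lemma probability_glue mu (J : {fset spacetime d}) : start_law F w0 mu ->
  P [set o | all (glue (w0 o) (dead F o)) J] =
  (mu [set w : config d r |
      all (fun z : spacetime d => (z.2 < 0)%R ==> glue w xpredT z) J] *
   P [set o | all (fun z : spacetime d => (0 <= z.2)%R ==> dead F o z) J])%E.
Proof.
move=> [[mw law] indep].
have mA : measurable
    [set w : config d r | all (fun z => (z.2 < 0) ==> glue w xpredT z) J].
  apply/measurable_fun_boolP/measurable_all => z.
  rewrite /glue; case: (z.2 < 0) => //=.
  by case: (insub z.2) => [s|] //; exact: (@measurable_eval (coordinate d r)).
rewrite -(law _ mA) -(indep _ _ mA).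
  congr (P _); apply/seteqP; split=> o /=.
    move=> /allP oJ; split; apply/allP => z /oJ; rewrite /glue.
      by case: ifP.
    by rewrite leNgt; case: ifP.
  move=> [/allP oJ /allP oJ']; apply/allP => z zJ.
  have := oJ _ zJ; have := oJ' _ zJ; rewrite /glue leNgt.
  by case: ifP.
(* Measurability on [S] amounts to membership in [future F]. *)
pose S := g_sigma_algebraType
  [set E | exists z A, 0 <= z.2 /\ E = F z @^-1` A].
suff : measurable_fun setT
    (fun o : S => all (fun z => (0 <= z.2) ==> dead F o z) J).
  by move/measurable_fun_boolP.
apply: measurable_all => z; case: leP => z0 //=.
apply/measurable_fun_boolP; apply: sub_sigma_algebra.
exists z, [set empty_upfamily d r]; split=> //.
by apply/seteqP; split=> o /= /eqP.
Qed.

End OneRun.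

(** Up to a null set, the run is a fixed measurable function [Phi] of the glued field, whose law is
    determined by [mu] and [rates]. *)
Lemma run_law_unique
    dT (T : measurableType dT) (P : probability T K)
    (F : spacetime d -> {RV P >-> upfamily d r}) (w0 : T -> config d r)
    dT' (T' : measurableType dT') (P' : probability T' K)
    (F' : spacetime d -> {RV P' >-> upfamily d r}) (w0' : T' -> config d r) mu :
  iid_field rates F -> iid_field rates F' ->
  start_law F w0 mu -> start_law F' w0' mu ->
  forall t A, measurable A -> P (run F w0 t @^-1` A) = P' (run F' w0' t @^-1` A).
Proof.
move=> hF hF' sF sF' t A mA.
have mw := sF.1.1; have mw' := sF'.1.1.
rewrite !run_deathE //.
pose Phi (u : field (spacetime d)) : config d r :=
  config_at (eta (with_death U u) (glued_past u)) t%:Z.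
have mPhi : measurable_fun setT Phi.
  apply: measurable_config_at => z; apply: measurable_eta => [y|].
    by apply: measurable_with_death; exact: measurable_eval.
  by apply: measurable_config => i; exact: measurable_eval.
have glueE w v : config_at (eta (with_death U v) w) t%:Z = Phi (glue w v).
  by apply/funext => i; rewrite /Phi /config_at glue_past eta_glue.
have mPhiA : measurable (Phi @^-1` A).
  by rewrite -[X in measurable X]setTI; exact: mPhi.
transitivity (P ((fun o => glue (w0 o) (dead F o)) @^-1` (Phi @^-1` A))).
  by congr (P _); apply/seteqP; split=> o /=; rewrite glueE.
transitivity (P' ((fun o => glue (w0' o) (dead F' o)) @^-1` (Phi @^-1` A))).
  apply: field_law_unique mPhiA; do ?exact: measurable_glue.
  move=> J; rewrite (probability_glue _ sF) (probability_glue _ sF').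
  congr (_ * _)%E; apply: (dead_law_unique hF hF'
    (A := [set v : field (spacetime d) | all (fun z => (0 <= z.2) ==> v z) J])).
  apply/measurable_fun_boolP/measurable_all => z; case: leP => //= _.
  exact: measurable_eval.
by congr (P' _); apply/seteqP; split=> o /=; rewrite glueE.
Qed.

End RunLaw.

(** * The upper invariant measure *)

Section ContinuousObservables.
Context {K : realType} {d : nat} {r : K}.
Implicit Types w : config d r.

(** Only finitely many coordinates are read, so an arbitrary [g] is allowed: the induction splits on
    the value of one coordinate at a time. *)
Lemma measurable_truncation dS (S : measurableType dS) (g : config d r -> S)
    (J : seq (coordinate d r)) :
  measurable_fun setT (fun w : config d r => g (fun i => (i \in J) && w i)).
Proof.
elim: J g => [|i J IH] g.
  exact: (measurable_cst (g (fun=> false))).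
rewrite (_ : (fun _ => _) = fun w : config d r =>
  if w i then g (fun j => (j == i) || (j \in J) && w j)
  else g (fun j => (j \in J) && w j)).
  apply: measurable_fun_ifT; last exact: IH.
    exact: (@measurable_eval (coordinate d r)).
  exact: (IH (fun u => g (fun j => (j == i) || u j))).
apply/funext => w; case wi: (w i); congr g; apply/funext => j; rewrite inE;
  by case: eqP => //= ->; rewrite wi ?andbF.
Qed.

Lemma cvg_observable (f : config d r -> K) (w_ : nat -> config d r) w :
  continuous (f : {ptws coordinate d r -> bool} -> K) ->
  (forall i, exists N, forall n, (N <= n)%N -> w_ n i = w i) ->
  f (w_ n) @[n --> \oo] --> f w.
Proof.
move=> cf w_w.
have : {ptws, w_ @ \oo --> (w : coordinate d r -> bool)}.
  rewrite cvg_sup => i.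
  rewrite cvg_image; last by rewrite eqEsubset; split=> v // _; exists (cst v).
  move=> W /nbhs_singleton Ww; have [N Nw] := w_w i.
  exists [set u | W (u i)]; first by exists N => // n /= /Nw ->.
  by rewrite eqEsubset; split => [_ [u + <-]//|b Wb]; exists (fun=> b).
by move=> /(cvg_comp _ _)/(_ (cf w)).
Qed.

Lemma measurable_observable (f : config d r -> K) :
  continuous (f : {ptws coordinate d r -> bool} -> K) ->
  measurable_fun setT f.
Proof.
move=> cf.
(* [J n] lists the coordinates of code below [n]. Setting all others to [false] gives configurations
   converging pointwise to [w], so [f] is a limit of measurable functions. *)
pose J n : seq (coordinate d r) := pmap choice.unpickle (iota 0 n).
apply: (measurable_fun_cvg (h := fun n w => f (fun i => (i \in J n) && w i))).
  by move=> n; exact: measurable_truncation.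
move=> w _; apply: cvg_observable => // i; exists (choice.pickle i).+1 => n ni.
suff -> : i \in J n by [].
rewrite mem_pmap; apply/mapP; exists (choice.pickle i); last by rewrite choice.pickleK.
by rewrite mem_iota.
Qed.

End ContinuousObservables.

Section UpperLimit.
Context {K : realType} {d : nat} {r : K}.
Variables (U : upfamily d r) (p : K) (rates : probability (upfamily d r) K).
Hypothesis hrates : forall A : set (upfamily d r),
  rates A = (p%:E * \d_U A + (1 - p)%:E * \d_(empty_upfamily d r) A)%E.
Context dT (T : measurableType dT) (P : probability T K).
Variables (F : spacetime d -> {RV P >-> upfamily d r}).
Hypothesis hF : iid_field rates F.

Definition run_ones (v : spacetime d -> bool) (t : nat) : config d r :=
  config_at (eta (with_death U v) (const_config d r true)) t%:Z.

(* Up to a translation of time, the process started from 1 at time [- t] and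
   observed at time 0. *)
Definition backward_run (t : nat) (o : T) : config d r :=
  run_ones (translate (- t%:Z) (dead F o)) t.

Lemma measurable_run_ones t :
  measurable_fun setT (fun v : field (spacetime d) => run_ones v t).
Proof.
apply: measurable_config_at => z; apply: measurable_eta => // y.
by apply: measurable_with_death; exact: measurable_eval.
Qed.

Lemma measurable_backward_run t : measurable_fun setT (backward_run t).
Proof.
apply: (measurableT_comp (measurable_run_ones t)); apply: measurable_field => z.
exact: measurable_dead.
Qed.

(** Stationarity of the deaths replaces a run on any probability space by the backward run on the
    fixed one, where convergence is pointwise and not only in law. *)
Lemma run_onesE dT' (T' : measurableType dT') (P' : probability T' K)
    (F' : spacetime d -> {RV P' >-> upfamily d r}) t A :
  iid_field rates F' -> measurable A ->
  P' (run F' (fun=> const_config d r true) t @^-1` A) = P (backward_run t @^-1` A).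
Proof.
move=> hF' mA; rewrite (run_deathE hrates hF') //.
rewrite -(dead_law (- t%:Z) hF hF' (A := (run_ones^~ t) @^-1` A)) //.
by rewrite -[X in measurable X]setTI; exact: measurable_run_ones.
Qed.

Lemma backward_run_eventually o i : exists N, forall t, (N <= t)%N ->
  backward_run t o i = survivors U (dead F o) i.
Proof.
pose z : spacetime d := (i.1, \val i.2).
have shiftE t : (i.1, t%:Z + \val i.2) = z + (0, t%:Z) :> spacetime d.
  by rewrite addrC; congr pair; rewrite addr0.
have [zC|zC] := boolP (z \in bp_closure (bp_of_ca U) (dead F o)).
  have [N NP] := eta_killed (const_config d r true) zC.
  exists N => t /NP; rewrite /backward_run /run_ones /config_at shiftE => ->.
  by rewrite /survivors -/z zC.
exists 0%N => t _; rewrite /backward_run /run_ones /config_at shiftE.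
rewrite /survivors -/z zC.
set v := translate _ _.
(* The run from 1 dominates the run from the survivors of the shifted field, which is exactly the
   complement of the closure. *)
apply: (@eta_mono _ _ _ _ (survivors U v)) => //.
rewrite eta_survivors.
  rewrite bp_closure_translate -addrA.
  have -> : (0, t%:Z) + (0, - t%:Z) = 0 :> spacetime d.
    by congr pair; rewrite /= ?addr0 ?subrr.
  by rewrite addr0.
by rewrite /= addrC; exact: past_shift.
Qed.

(** Coordinatewise convergence of the backward runs gives pointwise convergence of the continuous
    observable, and its bound [M] allows dominated convergence. *)
Lemma upper_invariant_measure_survivors :
  upper_invariant_measure rates (survivors_law (F := F) U).
Proof.
move=> dT' T' P' F' hF' f cf [M fM].
have mf := measurable_observable cf.
have mY t : measurable_fun setT (f \o backward_run t).
  exact: measurableT_comp mf (measurable_backward_run t).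
have mC : measurable_fun setT (f \o (fun o => survivors U (dead F o))).
  exact: measurableT_comp mf (measurable_initial U).
have intM : P.-integrable setT (EFin \o cst M).
  exact: finite_measure_integrable_cst.
have int_bounded (g : T -> K) : measurable_fun setT g -> (forall o, `|g o| <= M) ->
    P.-integrable setT (EFin \o g).
  move=> mg gM; apply: (le_integrable _ _ _ intM) => //.
    exact/measurable_EFinP.
  by move=> o _ /=; rewrite lee_fin (le_trans (gM o)) // ler_norm.
rewrite [X in _ --> X](_ : _ =
    \int[P]_o (f (survivors U (dead F o)))%:E)%E; last first.
  by rewrite integral_distribution //; [exact/measurable_EFinP|exact: int_bounded].
rewrite (_ : (fun t => _) = fun t => (\int[P]_o (f (backward_run t o))%:E)%E).
  have [] // := @dominated_convergence _ _ _ P _ measurableT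
    (fun t o => (f (backward_run t o))%:E)
    (fun o => (f (survivors U (dead F o)))%:E) (fun=> M%:E).
  - by move=> t; move/measurable_EFinP: (mY t).
  - by move/measurable_EFinP: mC.
  - apply: aeW => o _; apply/fine_cvgP; split; first exact: nearW.
    by apply: cvg_observable => // i; exact: backward_run_eventually.
  - by apply: aeW => o t _ /=; rewrite lee_fin.
apply/funext => t.
transitivity (\int[distribution P (rv_of P (measurable_backward_run t))]_w (f w)%:E)%E.
  have mr : measurable_fun setT (run F' (fun=> const_config d r true) t).
    exact: measurable_run.
  apply: (@eq_measure_integral _ _ _ setT
    (distribution P (rv_of P (measurable_backward_run t)))
    (distribution P' (rv_of P' mr))) => A mA _.
  exact: (run_onesE t hF' mA).
rewrite integral_distribution //; first exact/measurable_EFinP.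
exact: (int_bounded _ (mY t) (fun o => fM _)).
Qed.

Lemma survivors_translate (t : int) (v : spacetime d -> bool) :
  survivors U (translate t v) =
  config_at (fun z => z \notin bp_closure (bp_of_ca U) v) t.
Proof.
apply/funext => i; rewrite /survivors /config_at bp_closure_translate.
have -> // : (i.1, \val i.2) + (0, t) = (i.1, t + \val i.2) :> spacetime d.
by congr pair; [exact: addr0|exact: addrC].
Qed.

(** The closure commutes with time translations and the deaths are stationary. *)
Lemma shifted_survivors_law (t : int) A : measurable A ->
  P ((fun o => config_at (r := r)
      (fun z => z \notin bp_closure (bp_of_ca U) (dead F o)) t) @^-1` A) =
  P ((fun o => survivors U (dead F o)) @^-1` A).
Proof.
move=> mA.
have mS : measurable_fun setT (fun v : field (spacetime d) => survivors U v).
  apply: (@measurable_survivors _ _ _ _ (field (spacetime d)) U id) => z _.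
  exact: measurable_eval.
rewrite -[RHS](dead_translate t hF (A := (fun v => survivors U v) @^-1` A)).
  congr (P _); apply/seteqP; split=> o /=; rewrite -survivors_translate //.
by rewrite -[X in measurable X]setTI; exact: mS.
Qed.

End UpperLimit.

(** * Invariance and uniqueness *)

Section Invariance.
Context {K : realType} {d : nat} {r : K}.
Variables (U : upfamily d r) (p : K) (rates : probability (upfamily d r) K).
Hypothesis hrates : forall A : set (upfamily d r),
  rates A = (p%:E * \d_U A + (1 - p)%:E * \d_(empty_upfamily d r) A)%E.
Context dT (T : measurableType dT) (P : probability T K).
Variables (F : spacetime d -> {RV P >-> upfamily d r}).
Hypothesis hF : iid_field rates F.

Local Notation mu := (survivors_law (F := F) U).

Lemma invariant_survivors_law : invariant_measure rates mu.
Proof.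
move=> dT' T' P' F' w0 hF' sF' t; split.
  by apply: measurable_run; exact: sF'.1.1.
move=> A mA.
(* The law of the run does not depend on how the initial law is realised, so C_0 on the given space
   may be used; its run is the complement of the closure. *)
rewrite (run_law_unique hrates hF' hF sF' (start_law_survivors hF U)) //.
rewrite (run_deathE hrates hF) //; last exact: measurable_initial.
have -> : mu A = P ((fun o => survivors U (dead F o)) @^-1` A) by [].
rewrite -(shifted_survivors_law U hF t%:Z mA).
congr (P _); apply: (congr1 (fun X => X @^-1` A)).
apply/funext => o; apply/funext => i.
by rewrite /config_at eta_survivors //; exact: past_shift.
Qed.

End Invariance.

(** * Coupling with an independent initial configuration on a product space *)

Section ProductSpace.
Context {K : realType} {d : nat} {r : K} {rates : probability (upfamily d r) K}.
Context {dT} {T : measurableType dT} {P : probability T K}.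
Variables (F : spacetime d -> {RV P >-> upfamily d r}).
Variable nu : probability (config d r) K.
Hypothesis hF : iid_field rates F.

Definition product_law : probability (T * config d r)%type K := (P \x nu)%E.

Lemma measurable_product_field z : measurable_fun setT (F z \o @fst T (config d r)).
Proof. exact: measurableT_comp (measurable_up F z) measurable_fst. Qed.

Definition product_field (z : spacetime d) : {RV product_law >-> upfamily d r} :=
  rv_of product_law (measurable_product_field z).

Lemma product_lawE A B : measurable A -> measurable B ->
  product_law (A `*` B) = (P A * nu B)%E.
Proof. by move=> mA mB; exact: (product_measure1E P nu mA mB). Qed.

Lemma product_law_fst A : measurable A -> product_law (fst @^-1` A) = P A.
Proof.
move=> mA; rewrite (_ : _ @^-1` _ = A `*` setT).
  by rewrite product_lawE // probability_setT mule1.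
by apply/seteqP; split=> [[x w] /=|[x w] []].
Qed.

Lemma iid_product_field : iid_field rates product_field.
Proof.
have mF z A : measurable (F z @^-1` A).
  by rewrite -[X in measurable X]setTI; exact: measurable_up.
have fstE z A : product_law (product_field z @^-1` A) = P (F z @^-1` A).
  by rewrite -product_law_fst.
split=> [z|J A].
  split; first exact: measurable_up.
  by move=> A mA; rewrite fstE (hF.1 z).2.
rewrite (_ : \bigcap_(z in _) _ =
    fst @^-1` (\bigcap_(z in [set` J]) (F z @^-1` A z))).
  rewrite product_law_fst; last exact: fin_bigcap_measurable.
  by rewrite hF.2; apply: eq_bigr => z _; rewrite fstE.
by rewrite preimage_bigcap.
Qed.

Lemma start_law_product : start_law product_field snd nu.
Proof.
split.
  split; first exact: measurable_snd.
  move=> A mA; rewrite (_ : _ @^-1` _ = setT `*` A).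
    by rewrite product_lawE // probability_setT mul1e.
  by apply/seteqP; split=> [[x w] /=|[x w] []].
move=> A E mA fE.
(* A future event depends on the first component only, so its intersection with an initial event is
   a rectangle. *)
have [E' mE' <-] : preimage_set_system setT (@fst T (config d r)) measurable E.
  move: E fE; apply: smallest_sub.
    exact/sigma_algebra_preimage/sigma_algebra_measurable.
  move=> _ [z [B [_ ->]]]; exists (F z @^-1` B); last by rewrite setTI.
  by rewrite -[X in measurable X]setTI; exact: measurable_up.
rewrite setTI product_law_fst // (_ : _ `&` _ = E' `*` A); last first.
  by apply/seteqP; split=> [[x w] [] //=|[x w] []].
rewrite product_lawE // muleC; congr (_ * _)%E.
rewrite (_ : _ @^-1` _ = setT `*` A).
  by rewrite product_lawE // probability_setT mul1e.
by apply/seteqP; split=> [[x w] /=|[x w] []].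
Qed.

End ProductSpace.

Section Uniqueness.
Context {K : realType} {d : nat} {r : K}.

Lemma eq_invariant_measure (rates : probability (upfamily d r) K)
    (mu nu : probability (config d r) K) :
  (forall A, measurable A -> mu A = nu A) ->
  invariant_measure rates mu -> invariant_measure rates nu.
Proof.
move=> munu inv dT T P F w0 hF [[mw law] indep] t.
have [|mr lawr] := inv _ _ _ _ w0 hF _ t.
  by split=> //; split=> // A mA; rewrite munu // law.
by split=> // A mA; rewrite -munu // lawr.
Qed.

Lemma measurable_coordinate_set (i : coordinate d r) :
  measurable [set w : config d r | w i].
Proof.
apply/measurable_fun_boolP; exact: (@measurable_eval (coordinate d r)).
Qed.

(** There are countably many coordinates, so almost surely all of them vanish together. *)
Lemma dirac_of_null (nu : probability (config d r) K) :
  (forall i : coordinate d r, nu [set w | w i] = 0%E) ->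
  forall A, measurable A -> nu A = \d_(const_config d r false) A.
Proof.
move=> nu0 A mA.
have ae0 : {ae nu, forall w, forall i, w i = false}.
  apply: ae_forall_count => i; exists [set w | w i]; split => //.
    exact: measurable_coordinate_set.
  by move=> w /=; case: (w i).
rewrite diracE; have [/set_mem A0|A0] := boolP (_ \in A).
  rewrite -(probability_setT nu); apply: probability_ae_eq => //.
  move: ae0; apply: (@filterS _ _ (ae_filter_ringOfSetsType nu)) => w w0.
  by rewrite (_ : w = const_config d r false) //; apply/funext.
transitivity (nu set0); last by rewrite measure0.
apply: probability_ae_eq => //.
move: ae0; apply: (@filterS _ _ (ae_filter_ringOfSetsType nu)) => w w0.
rewrite (_ : w = const_config d r false); last exact/funext.
by split => // Aw; move: A0; rewrite mem_set.
Qed.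

Lemma continuous_coordinate (i : coordinate d r) :
  continuous ((fun w : config d r => (w i)%:R) : {ptws coordinate d r -> bool} -> K).
Proof.
move=> w; apply: cvg_near_cst.
have wi : nbhs w [set u : {ptws coordinate d r -> bool} | u i = w i].
  exact: (@proj_continuous _ (fun=> bool) i w _ (discrete_set1 _)).
by apply: filterS wi => u /= ->.
Qed.

Lemma upper_coordinate_cvg (rates : probability (upfamily d r) K)
    (mu : probability (config d r) K)
    dT (T : measurableType dT) (P : probability T K)
    (F : spacetime d -> {RV P >-> upfamily d r}) i :
  upper_invariant_measure rates mu -> iid_field rates F ->
  (P [set o | run F (fun=> const_config d r true) t o i] @[t --> \oo]
     --> mu [set w | w i])%E.
Proof.
move=> up hF.
have mi : measurable [set w : config d r | w i].
  exact: measurable_coordinate_set.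
have integralE (nu : {measure set (config d r) -> \bar K}) :
    (\int[nu]_w (w i)%:R%:E = nu [set w | w i])%E.
  transitivity (\int[nu]_w (\1_[set w : config d r | w i] w)%:E)%E.
    apply: eq_integral => w _; rewrite indicE.
    have -> // : (w \in [set w : config d r | w i]) = w i.
    by apply/idP/idP => [/set_mem|/mem_set].
  by rewrite integral_indic // setIT.
have := up _ _ _ _ hF _ (continuous_coordinate (i := i)).
rewrite integralE.
have mr t : measurable_fun setT (run F (fun=> const_config d r true) t).
  exact: measurable_run.
have -> : (fun t => \int[pushforward P (run F (fun=> const_config d r true) t)]_w
    (w i)%:R%:E)%E = fun t => P [set o | run F (fun=> const_config d r true) t o i].
  by apply/funext => t; exact: (integralE (distribution P (rv_of P (mr t)))).
by apply; exists 1 => w; rewrite normr_nat lern1 leq_b1.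
Qed.

(* On the product of [P] and [nu], the same deaths drive the processes started from
   [nu] and from 1, and the latter dominates. *)
Lemma null_coordinate (rates : probability (upfamily d r) K)
    (mu nu : probability (config d r) K)
    dT (T : measurableType dT) (P : probability T K)
    (F : spacetime d -> {RV P >-> upfamily d r}) i :
  iid_field rates F -> upper_invariant_measure rates mu ->
  invariant_measure rates nu -> (nu [set w | w i] <= mu [set w | w i])%E.
Proof.
move=> hF up inv.
have iid2 := iid_product_field nu hF.
have mi : measurable [set w : config d r | w i].
  exact: measurable_coordinate_set.
apply: (cvge_to_ge (upper_coordinate_cvg up iid2)).
apply: nearW => t.
have [mr law] := inv _ _ _ _ _ iid2 (start_law_product F nu) t.
rewrite -law //; apply: le_measure.
- by rewrite inE -[X in measurable X]setTI; exact: mr.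
- rewrite inE -[X in measurable X]setTI.
  by apply: (measurable_run (F := product_field F nu)
    (w0 := fun=> const_config d r true) t _ _ mi).
- by move=> o /=; apply: eta_mono.
Qed.

End Uniqueness.

(** If the closure is everything, the law of C_0 has zero density and, dominating every invariant
    measure, forces it to be the Dirac mass. Conversely, uniqueness applied to the law of C_0 puts
    each site in the closure almost surely. *)
Lemma extinction_criterion {K : realType} {d : nat} {r : K} (hr : 1 <= r)
    (U : upfamily d r) (p : K) (rates : probability (upfamily d r) K)
    (hrates : forall A : set (upfamily d r),
      rates A = (p%:E * \d_U A + (1 - p)%:E * \d_(empty_upfamily d r) A)%E)
    dT (T : measurableType dT) (P : probability T K)
    (F : spacetime d -> {RV P >-> upfamily d r}) (hF : iid_field rates F) :
  {ae P, forall o, bp_closure (bp_of_ca U) (dead F o) = setT} <->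
  invariant_measure rates (\d_(const_config d r false)) /\
  forall mu : probability (config d r) K, invariant_measure rates mu ->
    forall A, measurable A -> mu A = \d_(const_config d r false) A.
Proof.
pose mu := survivors_law (F := F) U.
have muE (i : coordinate d r) :
    mu [set w | w i] = P [set o | survivors U (dead F o) i] by [].
split=> [aeC|[_ unique]].
- have mu0 (i : coordinate d r) : mu [set w | w i] = 0%E.
    rewrite muE; transitivity (P set0); last by rewrite measure0.
    apply: probability_ae_eq => //.
      apply/measurable_fun_boolP.
      exact: (measurable_coordinate i (measurable_initial (F := F) U)).
    move: aeC; apply: filterS => o; rewrite /survivors /= => ->.
    by rewrite in_setT.
  split.
    apply: eq_invariant_measure (invariant_survivors_law hrates hF).
    exact: dirac_of_null.
  move=> nu inv; apply: dirac_of_null => i; apply/eqP.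
  rewrite eq_le measure_ge0 andbT; apply: le_trans (_ : mu [set w | w i] <= 0)%E.
    exact: (null_coordinate i hF
      (upper_invariant_measure_survivors hrates hF) inv).
  by rewrite mu0.
(* As [r] is at least 1, every configuration has a coordinate at time -1. Through it, a site [z] of
   arbitrary time is seen in the configuration at time [z.2 + 1]. *)
- have last_past : past r (-1).
    by rewrite /past /= in_itv /= ltrz0 mulrNz lerN2 hr.
  pose s : past r := SigSub (mem_set last_past).
  have aeC : {ae P, forall o, forall z : spacetime d,
      z \in bp_closure (bp_of_ca U) (dead F o)}.
    apply: ae_forall_count => z.
    have mi := measurable_coordinate_set (z.1, s).
    exists [set o | z \notin bp_closure (bp_of_ca U) (dead F o)]; split.
    + apply/measurable_fun_boolP; apply: measurable_neg.
      apply: (@measurable_closure _ _ _ _ _ U (dead F) (z.2 + 1)); last by rewrite ltrDl.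
      by move=> y _; exact: measurable_dead.
    + transitivity (mu [set w | w (z.1, s)]); last first.
        rewrite (unique mu (invariant_survivors_law hrates hF) _ mi).
        by rewrite diracE memNset.
      transitivity (P ((fun o => survivors U (dead F o)) @^-1`
        [set w | w (z.1, s)])); last by [].
      rewrite -(shifted_survivors_law U hF (z.2 + 1) mi).
      congr (P _); apply/seteqP.
      by split=> o /=; rewrite /config_at /= addrK; case: z {mi}.
    + by move=> o /= /negP.
  move: aeC; apply: filterS => o oC; apply/seteqP; split=> // z _.
  exact/set_mem.
Qed.

Theorem proposition3p1 (K : realType) (d : nat) (r : K)
    (hd : (1 <= d)%N) (hr : 1 <= r) :
  (forall (U : upfamily d r) (p : K) (hp : 0 <= p <= 1)
      (rates : probability (upfamily d r) K)
      (hrates : forall A : set (upfamily d r),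
        rates A = (p%:E * \d_U A + (1 - p)%:E * \d_(empty_upfamily d r) A)%E)
      (dT : measure_display) (T : measurableType dT) (P : probability T K)
      (F : spacetime d -> {RV P >-> upfamily d r}) (hF : iid_field rates F),
    let C (o : T) : set (spacetime d) :=
      bp_closure (bp_of_ca U) (fun z => F z o == empty_upfamily d r) in
    let C0 (o : T) : config d r := fun i => (i.1, \val i.2) \notin C o in
    [/\ {ae P, forall o, forall (t : nat) (x : 'rV[int]_d),
          eta (fun z => F z o) (C0 o) (x, t%:Z) = ((x, t%:Z) \notin C o)},
        exists mu : probability (config d r) K,
          [/\ upper_invariant_measure rates mu, invariant_measure rates mu,
              start_law F C0 mu & forall t : nat, has_law P (run F C0 t) mu] &
        {ae P, forall o, C o = setT} <->
        invariant_measure rates (\d_(const_config d r false)) /\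
        forall mu : probability (config d r) K, invariant_measure rates mu ->
          forall A, measurable A -> mu A = \d_(const_config d r false) A]) /\
  (forall U : upfamily d r, update_family_in_range d r (bp_of_ca U)) /\
  set_bij [set: upfamily d r]
    [set generated r X | X in update_family_in_range d r]
    (fun U => generated r (bp_of_ca U)).
Proof.
split; last first.
  by split; [exact: update_family_in_range_bp_of_ca|exact: set_bij_bp_of_ca].
move=> U p hp rates hrates dT T P F hF C C0; split.
- exact: (ae_survivors_law hrates hF).
- exists (survivors_law (F := F) U); split.
  + exact: (upper_invariant_measure_survivors hrates hF).
  + exact: (invariant_survivors_law hrates hF).
  + exact: (start_law_survivors hF U).
  (* Invariance is applied to the given field started from its own C_0, which is independent of the
     future. *)
  + by move=> t; exact: (invariant_survivors_law hrates hF hF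
      (start_law_survivors hF U)).
- exact: (extinction_criterion hr hrates hF).
Qed.
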